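(* Let $E\subseteq M$ and let $f:E\rightarrow\mathbb{I}$, $f(x)=\langle f^c(x),f^w(x)\rangle$, be an interval-valued function. Let $x\in E$ and let $\gamma:I\to M$, with $0\in I$ and $\gamma(I)\subseteq E$, be any geodesic with $\gamma(0)=x$ and $\dot\gamma(0)=X_x\in T_x(E)$ such that $(f^w\circ\gamma)(s)$ is non-decreasing for $s\in I\cap[0,\infty)$. Then the gH-directional derivative $Df(x;X_x)$ of $f$ at $x$ in the direction $X_x$ exists if and only if the directional derivatives $Df^c(x;X_x)$ and $Df^w(x;X_x)$ of $f^c$ and $f^w$ at $x$ in the direction $X_x$ both exist. Hence, in that case, $$Df(x;X_x)=\langle Df^c(x;X_x),\,Df^w(x;X_x)\rangle,$$ where $Df^w(x;X_x)\ge 0$.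
   Context: Throughout, $(M,g)$ is a complete finite-dimensional Riemannian manifold with its Riemannian connection. $\mathbb{I}$ is the set of closed bounded intervals of $\mathbb{R}$. An interval $A=[a^l,a^u]$ is also written $A=\langle a^c,a^w\rangle$ with center $a^c=\frac{a^l+a^u}{2}$ and half-width $a^w=\frac{a^u-a^l}{2}$. For $k\ge 0$, $kA=[ka^l,ka^u]$; for $k<0$, $kA=[ka^u,ka^l]$. The generalized Hukuhara (gH) difference is $A\ominus_{gH}B=[\min\{a^l-b^l,a^u-b^u\},\max\{a^l-b^l,a^u-b^u\}]$. Limits of interval-valued functions are taken with respect to the Hausdorff distance $d_H(A,B)=\max\{|a^l-b^l|,|a^u-b^u|\}$. An interval-valued function (IVF) on $E\subseteq M$ is a map $f:E\to\mathbb{I}$, written $f(x)=\langle f^c(x),f^w(x)\rangle$, with $f^c,f^w:E\to\mathbb{R}$ and $f^w\ge 0$. $T_x(E)$ denotes the set of tangent vectors to $E$ at $x$; directional derivatives are taken in directions $X_x\in T_x(E)$ for which there is a geodesic $\gamma$ defined on an interval $I\ni 0$ containing some $s>0$, with $\gamma(I)\subseteq E$, $\gamma(0)=x$, $\dot\gamma(0)=X_x$. For such a $\gamma$, the directional derivative of a real-valued $h:E\to\mathbb{R}$ is $Dh(x;X_x)=\lim_{s\to0^+}\frac{h(\gamma(s))-h(x)}{s}$, when this (finite) limit exists, and the gH-directional derivative of an IVF $f$ is $Df(x;X_x)=\lim_{s\to0^+}\frac1s\big(f(\gamma(s))\ominus_{gH}f(x)\big)\in\mathbb{I}$, when this limit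 exists. *)

(* Defs.v *)
From HB Require Import structures.
From mathcomp Require Import all_boot all_order all_algebra.
From mathcomp Require Import all_classical all_reals all_analysis.
Set Implicit Arguments.
Unset Strict Implicit.
Unset Printing Implicit Defensive.
Import Order.TTheory GRing.Theory Num.Theory.
Import numFieldNormedType.Exports.
Local Open Scope classical_set_scope.
Local Open Scope ring_scope.

Section ClosedBoundedIntervals.
Variable R : realType.

Record cbitv := Cbitv { lower : R; upper : R; lower_le_upper : lower <= upper }.

Definition cbitv_center (A : cbitv) : R := (lower A + upper A) / 2.
Definition cbitv_halfwidth (A : cbitv) : R := (upper A - lower A) / 2.

Lemma center_halfwidth_le (c w : R) : 0 <= w -> c - w <= c + w.
Proof. by move=> w0; rewrite lerD2l ge0_cp. Qed.

(* The interval <c, w>. *)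
Definition cbitv_cw (c w : R) (w_ge0 : 0 <= w) : cbitv :=
  Cbitv (center_halfwidth_le c w_ge0).

Lemma scale_cbitv_le k (A : cbitv) :
  (if 0 <= k then k * lower A else k * upper A) <=
  (if 0 <= k then k * upper A else k * lower A).
Proof.
case: A => l u lu /=; case: (leP 0 k) => k0; first exact: ler_wpM2l.
exact: ler_wnM2l (ltW k0) _ _ lu.
Qed.

Definition scale_cbitv k (A : cbitv) : cbitv := Cbitv (scale_cbitv_le k A).

Lemma gH_diff_le (A B : cbitv) :
  Num.min (lower A - lower B) (upper A - upper B) <=
  Num.max (lower A - lower B) (upper A - upper B).
Proof. by rewrite ge_min !le_max !lexx. Qed.

Definition gH_diff (A B : cbitv) : cbitv := Cbitv (gH_diff_le A B).

Definition hausdorff_dist (A B : cbitv) : R :=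
  Num.max `|lower A - lower B| `|upper A - upper B|.

End ClosedBoundedIntervals.

Section EuclideanCalculus.
Variables (R : realType) (n : nat).

Definition partial (i : 'I_n) (f : 'rV[R]_n -> R) : 'rV[R]_n -> R :=
  fun y => 'D_(delta_mx 0 i) f y.

Fixpoint Ck_on (k : nat) (U : set 'rV[R]_n) (f : 'rV[R]_n -> R) : Prop :=
  (forall y, U y -> {for y, continuous f}) /\
  if k is k'.+1 then
    forall i : 'I_n,
      (forall y, U y -> derivable f y (delta_mx 0 i)) /\
      Ck_on k' U (partial i f)
  else True.

Definition smooth_on (U : set 'rV[R]_n) (f : 'rV[R]_n -> R) : Prop :=
  forall k, Ck_on k U f.

(* The derivative of [u] at [t] relative to [I]: one-sided when [t] is an
   endpoint of the interval [I]. *)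
Definition has_derivative_within (I : set R) (u : R -> 'rV[R]_n) (t : R)
    (v : 'rV[R]_n) : Prop :=
  (s - t)^-1 *: (u s - u t) @[s --> within I (t^')] --> v.

End EuclideanCalculus.

Section Charts.
Variables (R : realType) (n : nat) (M : topologicalType).

(* [chart_map] and [chart_inv] are meaningful only on [chart_dom] and on
   [chart_cod] respectively. *)
Record chart := Chart {
  chart_dom : set M;
  chart_map : M -> 'rV[R]_n;
  chart_inv : 'rV[R]_n -> M;
  chart_dom_open : open chart_dom;
  chart_cod_open : open (chart_map @` chart_dom);
  chart_mapK : forall p, chart_dom p -> chart_inv (chart_map p) = p;
  chart_map_continuous : {within chart_dom, continuous chart_map};
  chart_inv_continuous : {within chart_map @` chart_dom, continuous chart_inv}
}.

Definition chart_cod (c : chart) : set 'rV[R]_n := chart_map c @` chart_dom c.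

Definition transition (c d : chart) : 'rV[R]_n -> 'rV[R]_n :=
  chart_map d \o chart_inv c.

Definition transition_dom (c d : chart) : set 'rV[R]_n :=
  chart_map c @` (chart_dom c `&` chart_dom d).

End Charts.

(* A Riemannian manifold of dimension [n], by a smooth atlas and the local
   matrices of the metric tensor. Vectors are rows, so the differential of the
   transition map acts by right multiplication by its Jacobian. *)
Record riemannian_manifold (R : realType) (n : nat) (M : topologicalType) :=
  RiemannianManifold {
    manifold_hausdorff : hausdorff_space M;
    manifold_second_countable : @second_countable M;
    atlas : set (chart R n M);
    atlas_cover : forall p : M, exists2 c, atlas c & chart_dom c p;
    atlas_smooth : forall c d, atlas c -> atlas d -> forall k : 'I_n,
      smooth_on (transition_dom c d) (fun y => transition c d y 0 k);
    metric : chart R n M -> 'rV[R]_n -> 'M[R]_n;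
    metric_smooth : forall c, atlas c -> forall i j : 'I_n,
      smooth_on (chart_cod c) (fun y => metric c y i j);
    metric_sym : forall c y, atlas c -> chart_cod c y ->
      (metric c y)^T = metric c y;
    metric_pos : forall c y (v : 'rV[R]_n), atlas c -> chart_cod c y ->
      v != 0 -> 0 < (v *m metric c y *m v^T) 0 0;
    metric_change : forall c d y, atlas c -> atlas d -> transition_dom c d y ->
      metric c y = jacobian (transition c d) y
                   *m metric d (transition c d y)
                   *m (jacobian (transition c d) y)^T
  }.

Section RiemannianGeometry.
Variables (R : realType) (n : nat) (M : topologicalType).
Variable G : riemannian_manifold R n M.

(* A tangent vector at [x] is given by its components in all charts around [x];
   the components in the other charts are irrelevant. *)
Record tangent (x : M) := Tangent {
  components :> chart R n M -> 'rV[R]_n;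
  components_change : forall c d, atlas G c -> atlas G d ->
    chart_dom c x -> chart_dom d x ->
    components d =
      components c *m jacobian (transition c d) (chart_map c x)
}.

Definition has_velocity (I : set R) (gamma : R -> M) (t : R) (x : M)
    (X : tangent x) : Prop :=
  gamma t = x /\
  forall c, atlas G c -> chart_dom c x ->
    has_derivative_within I (chart_map c \o gamma) t (X c).

(* Christoffel symbol of the Levi-Civita connection, upper index [k]. *)
Definition christoffel (c : chart R n M) (y : 'rV[R]_n) (k i j : 'I_n) : R :=
  2^-1 * \sum_(l < n) invmx (metric G c y) k l *
    (partial i (fun z => metric G c z j l) y
     + partial j (fun z => metric G c z i l) y
     - partial l (fun z => metric G c z i j) y).

(* Constant geodesics are allowed; [w] is the velocity in the chart [c]. *)
Definition is_geodesic (I : set R) (gamma : R -> M) : Prop :=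
  {within I, continuous gamma} /\
  forall c, atlas G c -> exists w : R -> 'rV[R]_n,
    forall t, I t -> chart_dom c (gamma t) ->
      has_derivative_within I (chart_map c \o gamma) t (w t) /\
      has_derivative_within I w t
        (\row_(k < n) - (\sum_(i < n) \sum_(j < n)
           christoffel c (chart_map c (gamma t)) k i j * w t 0 i * w t 0 j)).

(* Geodesic completeness. *)
Definition complete_manifold : Prop :=
  forall (x : M) (X : tangent x),
    exists gamma : R -> M, is_geodesic setT gamma /\ has_velocity setT gamma 0 X.

(* T_x(E): velocities at [x] of curves starting at [x] and staying in [E]. *)
Definition tangent_set (E : set M) (x : M) : set (tangent x) :=
  [set X | exists (e : R) (gamma : R -> M),
     [/\ 0 < e, {within `[0, e[, continuous gamma},
         forall s, `[0, e[%classic s -> E (gamma s) &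
         has_velocity `[0, e[ gamma 0 X]].

Definition geodesic_in (E : set M) (x : M) (X : tangent x) (I : set R)
    (gamma : R -> M) : Prop :=
  [/\ is_interval I, I 0, exists2 s, I s & 0 < s,
      forall s, I s -> E (gamma s) &
      is_geodesic I gamma /\ has_velocity I gamma 0 X].

(* Dh(x; X) = a. Functions on E are represented by functions on M, of which
   only the values on E matter. By local uniqueness of geodesics the limit does
   not depend on the geodesic. *)
Definition has_dir_derivative (E : set M) (h : M -> R) (x : M) (X : tangent x)
    (a : R) : Prop :=
  exists (I : set R) (gamma : R -> M),
    geodesic_in E X I gamma /\
    (h (gamma s) - h x) / s @[s --> 0^'+] --> a.

(* Df(x; X) = A for an interval-valued f, the limit being taken with respect to
   the Hausdorff distance. *)
Definition has_gH_dir_derivative (E : set M) (f : M -> cbitv R) (x : M)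
    (X : tangent x) (A : cbitv R) : Prop :=
  exists (I : set R) (gamma : R -> M),
    geodesic_in E X I gamma /\
    hausdorff_dist (scale_cbitv s^-1 (gH_diff (f (gamma s)) (f x))) A
      @[s --> 0^'+] --> (0 : R).

End RiemannianGeometry.

(* Main.v *)
Require Import Defs.
From HB Require Import structures.
From mathcomp Require Import all_boot all_order all_algebra.
From mathcomp Require Import all_classical all_reals all_analysis.
From mathcomp Require Import ring lra.
Set Implicit Arguments.
Unset Strict Implicit.
Unset Printing Implicit Defensive.
Import Order.TTheory GRing.Theory Num.Theory.
Import numFieldNormedType.Exports.
Local Open Scope classical_set_scope.
Local Open Scope ring_scope.

(** The interval part is elementary. Along the given geodesic the half-width
    does not decrease, so the gH-difference of [f (gamma s)] and [f x] is the
    plain endpoint-wise difference, and dividing by [s > 0] preserves the order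
    of the endpoints. Convergence in the Hausdorff distance is convergence of
    both endpoints, and center and half-width are invertible linear
    combinations of the endpoints; hence the quotient of [f] converges to [A]
    exactly when those of its center and its half-width converge to the center
    and the half-width of [A] ([cvg_gH_quotient]). The quotients of the
    half-width are nonnegative, so their limit is, and it can serve as the
    half-width of an interval.

    The geometric part is that a directional derivative may be witnessed by any
    geodesic with velocity [X], whereas monotonicity of the half-width is known
    along [gamma] only. It is bridged by local uniqueness: two geodesics with
    the same initial velocity agree for small [s >= 0]
    ([geodesic_local_unique]), so that all the limits may be taken along
    [gamma] ([has_dir_derivative_along], [has_gH_dir_derivative_along]).

    In a chart, position and velocity of a geodesic solve a first-order system
    whose right-hand side is built from the Christoffel symbols. These are
    rational expressions in the metric coefficients and their first partial
    derivatives, with a nonvanishing determinant as denominator, so they are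
    Lipschitz near every point ([lipschitz_near_christoffel]), because C^1
    functions are ([lipschitz_near_Ck]). Uniqueness for such a system
    ([ode_unique]) follows from the mean value theorem: on an interval of
    length [e] the maximum of the distance between two solutions is at most
    [L * e] times itself, and [L * e <= 1/2] for small [e]. *)

(** * Functions that are Lipschitz near a point *)

Section Lipschitz.
Variable R : realType.

(** The bound concerns pairs of points that are both near [p], since two
    solutions of a differential equation are compared with each other and not
    with their initial value. *)
Definition lipschitz_near (V : normedModType R) (p : V) (f : V -> R) : Prop :=
  exists2 k : R, 0 <= k & \forall yz \near (p, p),
    `|f yz.1 - f yz.2| <= k * `|yz.1 - yz.2|.

Section Algebra.
Variables (V : normedModType R) (p : V).
Implicit Types f g : V -> R.

Lemma near_diag (P : V -> Prop) : (\forall y \near p, P y) ->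
  \forall yz \near (p, p), P yz.1 /\ P yz.2.
Proof. by move=> Pp; exists (P, P). Qed.

Lemma lipschitz_near_eq f g : (\forall y \near p, f y = g y) ->
  lipschitz_near p f -> lipschitz_near p g.
Proof.
move=> /near_diag fg [k k0 kf]; exists k => //.
by apply: filterS2 fg kf => -[y z] /= [-> ->].
Qed.

Lemma lipschitz_near_cst a : lipschitz_near p (fun=> a).
Proof.
by exists 0 => //; near=> y; rewrite subrr normr0 mul0r.
Unshelve. all: by end_near. Qed.

Lemma lipschitz_near_continuous f : lipschitz_near p f -> {for p, continuous f}.
Proof.
move=> [k k0 kf].
have kp : \forall y \near p, `|f y - f p| <= k * `|y - p|.
  case: kf => -[A B] /= [Ap Bp] AB.
  by apply: filterS Ap => y Ay; apply: (AB (y, p)); split => //=;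
    exact: nbhs_singleton.
apply/cvgrPdist_le => e e0.
have e1 : 0 < e / (k + 1) by rewrite divr_gt0// ltr_wpDl.
near=> y.
rewrite distrC (@le_trans _ _ (k * `|y - p|))//; first by near: y.
have yp : `|y - p| <= e / (k + 1).
  by rewrite distrC; near: y; exact: cvgr_dist_le cvg_id _ e1.
rewrite (@le_trans _ _ ((k + 1) * (e / (k + 1))))//; last first.
  by rewrite mulrC divfK// gt_eqF// ltr_wpDl.
by rewrite ler_pM// lerDl.
Unshelve. all: by end_near. Qed.

Lemma lipschitz_nearD f g : lipschitz_near p f -> lipschitz_near p g ->
  lipschitz_near p (fun y => f y + g y).
Proof.
move=> [k k0 kf] [l l0 lg]; exists (k + l); first exact: addr_ge0.
apply: filterS2 kf lg => -[y z] /= kf lg.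
rewrite opprD addrACA (le_trans (ler_normD _ _))// mulrDl.
exact: lerD.
Qed.

Lemma lipschitz_nearM f g : lipschitz_near p f -> lipschitz_near p g ->
  lipschitz_near p (fun y => f y * g y).
Proof.
move=> lipf lipg.
have cf := lipschitz_near_continuous lipf.
have cg := lipschitz_near_continuous lipg.
move: lipf lipg => [k k0 kf] [l l0 lg].
exists ((`|f p| + 1) * l + (`|g p| + 1) * k).
  by rewrite addr_ge0// mulr_ge0// addr_ge0.
have bnd (h : V -> R) : {for p, continuous h} ->
    \forall y \near p, `|h y| <= `|h p| + 1.
  move=> ch.
  have : \forall y \near p, `|h p - h y| <= 1 by exact: (cvgr_dist_le _ _ ch).
  apply: filterS => y; rewrite distrC => hy.
  by rewrite -lerBlDl (le_trans (lerB_dist _ _)).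
move: (near_diag (bnd _ cf)) (near_diag (bnd _ cg)) => bf bg.
near=> yz.
have -> : f yz.1 * g yz.1 - f yz.2 * g yz.2 =
  f yz.1 * (g yz.1 - g yz.2) + g yz.2 * (f yz.1 - f yz.2) by ring.
rewrite (le_trans (ler_normD _ _))// !normrM mulrDl -!mulrA.
apply: lerD; apply: ler_pM => //.
- by have [] : `|f yz.1| <= `|f p| + 1 /\ `|f yz.2| <= `|f p| + 1 by near: yz.
- by near: yz.
- by have [] : `|g yz.1| <= `|g p| + 1 /\ `|g yz.2| <= `|g p| + 1 by near: yz.
- by near: yz.
Unshelve. all: by end_near. Qed.

Lemma lipschitz_nearZ a f : lipschitz_near p f ->
  lipschitz_near p (fun y => a * f y).
Proof. exact: lipschitz_nearM (lipschitz_near_cst a). Qed.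

Lemma lipschitz_nearN f : lipschitz_near p f ->
  lipschitz_near p (fun y => - f y).
Proof.
by move=> [k k0 kf]; exists k => //; apply: filterS kf => y;
  rewrite -opprD normrN.
Qed.

(** Near [p] the values of [f] are bounded away from 0, by half of [`|f p|]. *)
Lemma lipschitz_nearV f : f p != 0 -> lipschitz_near p f ->
  lipschitz_near p (fun y => (f y)^-1).
Proof.
move=> fp0 lipf.
have cf := lipschitz_near_continuous lipf.
move: lipf => [k k0 kf].
pose c := `|f p| / 2.
have c0 : 0 < c by rewrite divr_gt0// normr_gt0.
have bf : \forall y \near p, c <= `|f y|.
  have : \forall y \near p, `|f p - f y| <= c by exact: (cvgr_dist_le _ _ cf).
  apply: filterS => y fy.
  have : `|f p| <= `|f y| + c by rewrite -lerBlDl (le_trans (lerB_dist _ _)).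
  by rewrite [X in X <= _](splitr `|f p|) lerD2r.
exists (k / c ^+ 2); first by rewrite divr_ge0// sqr_ge0.
apply: filterS2 (near_diag bf) kf => -[y z] /= [cy cz] kf.
have y0 : f y != 0 by rewrite -normr_gt0 (lt_le_trans c0).
have z0 : f z != 0 by rewrite -normr_gt0 (lt_le_trans c0).
have -> : (f y)^-1 - (f z)^-1 = (f z - f y) / (f y * f z).
  by field; rewrite ?y0 ?z0.
rewrite normrM normfV normrM distrC mulrAC.
apply: ler_pM => //; rewrite ?invr_ge0 ?mulr_ge0//.
by rewrite lef_pV2 ?posrE ?exprn_gt0 ?mulr_gt0 ?normr_gt0// expr2 ler_pM// ltW.
Qed.

Lemma lipschitz_near_sum (J : finType) (F : J -> V -> R) :
  (forall i, lipschitz_near p (F i)) ->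
  lipschitz_near p (fun y => \sum_i F i y).
Proof.
move=> lipF; elim: (index_enum J) => [|i s IHs].
  by under eq_fun do rewrite big_nil; exact: lipschitz_near_cst.
by under eq_fun do rewrite big_cons; exact: lipschitz_nearD.
Qed.

Lemma lipschitz_near_prod (J : finType) (F : J -> V -> R) :
  (forall i, lipschitz_near p (F i)) ->
  lipschitz_near p (fun y => \prod_i F i y).
Proof.
move=> lipF; elim: (index_enum J) => [|i s IHs].
  by under eq_fun do rewrite big_nil; exact: lipschitz_near_cst.
by under eq_fun do rewrite big_cons; exact: lipschitz_nearM.
Qed.

Lemma lipschitz_near_det m (A : V -> 'M[R]_m) :
  (forall i j, lipschitz_near p (fun y => A y i j)) ->
  lipschitz_near p (fun y => \det (A y)).
Proof.
move=> lipA; apply: lipschitz_near_sum => s.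
by apply: lipschitz_nearZ; exact: lipschitz_near_prod.
Qed.

(** By Cramer's rule the entries of the inverse are cofactors divided by the
    determinant; the rule is available only near [p], since elsewhere the matrix
    may be singular. *)
Lemma lipschitz_near_invmx m (A : V -> 'M[R]_m) : A p \in unitmx ->
  (forall i j, lipschitz_near p (fun y => A y i j)) ->
  forall i j, lipschitz_near p (fun y => invmx (A y) i j).
Proof.
rewrite unitmxE unitfE => Ap lipA i j.
have lipdet := lipschitz_near_det lipA.
apply: (@lipschitz_near_eq (fun y => (\det (A y))^-1 * cofactor (A y) j i)).
  have : \forall y \near p, \det (A y) != 0.
    exact: (cvgr_neq0 _ (lipschitz_near_continuous lipdet) Ap).
  by apply: filterS => y Ay; rewrite /invmx unitmxE unitfE Ay !mxE.
apply: lipschitz_nearM; first exact: lipschitz_nearV.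
apply: lipschitz_nearZ; apply: lipschitz_near_det => a b.
by under eq_fun do rewrite !mxE.
Qed.

Lemma lipschitz_near_comp (W : normedModType R) (h : W -> V) (q : W) f :
  h q = p -> {for q, continuous h} ->
  (forall y z, `|h y - h z| <= `|y - z|) ->
  lipschitz_near p f -> lipschitz_near q (f \o h).
Proof.
move=> hq ch h1 [k k0 [[A B] /= [Ap Bp] AB]]; exists k => //.
rewrite -hq in Ap Bp.
exists (h @^-1` A, h @^-1` B); first by split; exact: ch.
move=> [y z] /= [Ay Bz]; apply: le_trans (AB (h y, h z) _) _ => //=.
exact: ler_wpM2l.
Qed.

End Algebra.
End Lipschitz.

(** * C^1 functions are locally Lipschitz *)

Section RowNorm.
Variable R : realType.

Lemma mx_norm_leP m n (A : 'M[R]_(m, n)) (k : R) : 0 <= k ->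
  reflect (forall i j, `|A i j| <= k) (`|A| <= k).
Proof.
move=> k0; rewrite [`|A|]mx_normrE; apply: (iffP idP).
  move=> /bigmax_leP [_ Ak] i j; exact: (Ak (i, j) isT).
by move=> Ak; apply/bigmax_leP; split => // -[i j] _; exact: Ak.
Qed.

Lemma le_mx_norm m n (A : 'M[R]_(m, n)) i j : `|A i j| <= `|A|.
Proof. by have /mx_norm_leP := lexx `|A|; apply. Qed.

Lemma lipschitz_near_coord n (p : 'rV[R]_n) (k : 'I_n) :
  lipschitz_near p (fun y => y 0 k).
Proof.
exists 1 => //; near=> yz.
rewrite mul1r (le_trans _ (le_mx_norm (yz.1 - yz.2) 0 k))//.
by rewrite !mxE.
Unshelve. all: by end_near. Qed.

Lemma is_derive_line n (f : 'rV[R]_n -> R) (y v : 'rV[R]_n) (s : R) :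
  derivable f (y + s *: v) v ->
  is_derive s (1 : R) (fun t => f (y + t *: v)) ('D_v f (y + s *: v)).
Proof.
move=> dfv.
have E : (fun h : R =>
     h^-1 *: (((fun t : R => f (y + t *: v)) \o shift s) (h *: (1 : R))
     - f (y + s *: v))) =
  (fun h => h^-1 *: ((f \o shift (y + s *: v)) (h *: v) - f (y + s *: v))).
  apply/funext => h /=; congr (_ *: (f _ - _)).
  by rewrite scaler1 scalerDl addrCA.
by apply: DeriveDef; rewrite ?/derivable ?/derive /= E.
Qed.

Lemma le_increment_on_line n (f : 'rV[R]_n -> R) (y v : 'rV[R]_n) (K t : R) :
  0 <= t ->
  (forall s, 0 <= s <= t -> derivable f (y + s *: v) v /\
     `|'D_v f (y + s *: v)| <= K) ->
  `|f (y + t *: v) - f y| <= K * t.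
Proof.
move=> t0 fK.
have dg s : 0 <= s <= t ->
    is_derive s (1 : R) (fun t => f (y + t *: v)) ('D_v f (y + s *: v)).
  by move=> /fK [dfv _]; exact: is_derive_line.
have [s||c + cE] := @MVT_segment R (fun t => f (y + t *: v))
    (fun s => 'D_v f (y + s *: v)) 0 t t0.
- by rewrite in_itv/= => /andP[s0 st]; apply: dg; rewrite !ltW.
- apply: derivable_within_continuous => s; rewrite in_itv/= => /dg ?.
  exact: ex_derive.
- rewrite in_itv/= => /fK [_ cK].
  move: cE; rewrite scale0r addr0 subr0 => ->.
  by rewrite normrM (ger0_norm t0) ler_wpM2r.
Qed.

(** On a ball around [p] all partial derivatives are bounded by one constant
    [K]. Two points of the ball are joined by changing one coordinate at a time;
    balls of the maximum norm are boxes, so this path stays inside, and the mean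
    value theorem bounds each of the [n] increments by [K] times the distance. *)
Lemma lipschitz_near_Ck n (U : set 'rV[R]_n) (f : 'rV[R]_n -> R) p :
  open U -> U p -> Ck_on 1 U f -> lipschitz_near p f.
Proof.
move=> oU Up [_ df].
pose K := \sum_(i < n) (`|partial i f p| + 1).
have K0 : 0 <= K by apply: sumr_ge0 => i _; rewrite addr_ge0.
have : \forall y \near p, U y /\ forall i, `|partial i f y| <= K.
  have Unear : \forall y \near p, U y by exact: open_nbhs_nbhs.
  have dfK i : \forall y \near p, `|partial i f y| <= K.
    have [_ [cf _]] := df i.
    have df1 : \forall y \near p, `|partial i f p - partial i f y| <= 1.
      exact: (cvgr_dist_le _ _ (cf p Up)).
    apply: filterS df1 => y py.
    rewrite /K (bigD1 i)//= ler_wpDr//.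
      by apply: sumr_ge0 => j _; rewrite addr_ge0.
    by rewrite -lerBlDl (le_trans (lerB_dist _ _))// distrC.
  by apply: filterS2 Unear (@filter_forall _ _ _ _ _ dfK) => y.
move=> /nbhs_ballP [e /= e0 pe].
(* The increment of [f] when only coordinate [i] changes. *)
have step i (y z : 'rV[R]_n) : ball p e y -> ball p e z ->
    (forall j, j != i -> y 0 j = z 0 j) ->
    `|f z - f y| <= K * `|z 0 i - y 0 i|.
  wlog yz : y z / y 0 i <= z 0 i => [hw|] py pz yzi.
    have [yz|/ltW zy] := leP (y 0 i) (z 0 i); first exact: hw.
    by rewrite distrC (distrC (z 0 i)); apply: hw => // j /yzi.
  have -> : z = y + (z 0 i - y 0 i) *: delta_mx 0 i.
    apply/rowP => j; rewrite !mxE eqxx/=.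
    have [->|/yzi ->] := eqVneq j i; first by rewrite mulr1 addrC subrK.
    by rewrite mulr0 addr0.
  rewrite [X in _ <= K * `|X|](_ : _ = z 0 i - y 0 i); last first.
    by rewrite !mxE !eqxx/=; ring.
  rewrite (ger0_norm (_ : 0 <= z 0 i - y 0 i)) ?subr_ge0//.
  apply: le_increment_on_line; first by rewrite subr_ge0.
  move=> s /andP[s0 sz].
  have /pe [Us Ks] : ball p e (y + s *: delta_mx 0 i).
    split => // a j; rewrite !mxE ord1 eqxx/=.
    have [->|ji] := eqVneq j i; last first.
      by rewrite mulr0 addr0; case: py => _; exact.
    rewrite mulr1.
    case: py => _ /(_ 0 i) /=; case: pz => _ /(_ 0 i) /=.
    rewrite /ball /= !ltr_distlC => /andP[z1 z2] /andP[y1 y2]; apply/andP; split.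
      by rewrite (lt_le_trans y1)// lerDl.
    by rewrite (le_lt_trans _ z2)// -lerBrDl.
  by split; [have [+ _] := df i; exact|exact: Ks].
exists (\sum_(i < n) K); first exact: sumr_ge0.
exists (ball p e, ball p e); first by split; exact: nbhsx_ballx.
move=> [y z] /= [py pz].
(* The vertices of the path from [z] to [y]. *)
pose mix (k : nat) := \row_(j < n) (if (j < k)%N then y 0 j else z 0 j).
have mb k : ball p e (mix k).
  split => // a j; rewrite !mxE ord1.
  by case: ifP => _; [case: py|case: pz] => _; exact.
have -> : f y - f z = \sum_(i < n) (f (mix i.+1) - f (mix i)).
  rewrite -(big_mkord xpredT (fun i => f (mix i.+1) - f (mix i))) telescope_sumr//.
  by congr (f _ - f _); apply/rowP => j; rewrite !mxE// ltn_ord.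
rewrite (le_trans (ler_norm_sum _ _ _))// mulr_suml ler_sum// => i _.
have := step i (mix i) (mix i.+1) (mb _) (mb _); rewrite !mxE ltnn ltnSn.
move=> h; apply: le_trans (h _) _ => [j ji|].
  by rewrite !mxE ltnS [(j <= i)%N]leq_eqVlt -[(j == i :> nat)]/(j == i) (negbTE ji).
rewrite ler_wpM2l// (le_trans _ (le_mx_norm (y - z) 0 i))//.
by rewrite !mxE.
Unshelve. all: by end_near. Qed.

End RowNorm.

(** * Uniqueness of solutions of differential equations *)

Section OneSidedDerivative.
Variable R : realType.
Implicit Types (I J : set R) (h : R -> R) (t a : R).

(** The scalar counterpart of [has_derivative_within]; curves are handled
    through their coordinates because the mean value theorem is scalar. *)
Definition derivative_within J h t a : Prop :=
  (s - t)^-1 * (h s - h t) @[s --> within J (t^')] --> a.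

Lemma derivative_within_subset I J h t a : J `<=` I ->
  derivative_within I h t a -> derivative_within J h t a.
Proof.
move=> JI; apply: cvg_trans; apply: cvg_app => P /= IP.
have {}IP : \forall s \near t^', I s -> P s := IP.
suff : \forall s \near t^', J s -> P s by [].
by apply: filterS IP => s Ps Js; apply: Ps; exact: JI.
Qed.

Lemma derivative_within_continuous J h t a : derivative_within J h t a ->
  h s @[s --> within J (nbhs t)] --> h t.
Proof.
move=> /cvgrPdist_le /(_ 1 ltr01) hq.
have {}hq : \forall s \near t, s != t -> J s ->
  `|a - (s - t)^-1 * (h s - h t)| <= 1 := hq.
apply/cvgrPdist_le => e e0.
suff : \forall s \near t, J s -> `|h t - h s| <= e by [].
have e1 : 0 < e / (`|a| + 1) by rewrite divr_gt0// ltr_wpDl.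
have : \forall s \near t, `|t - s| <= e / (`|a| + 1).
  exact: (@cvgr_dist_le _ _ _ _ _ _ _ (@cvg_id _ (nbhs t))).
apply: filterS2 hq => s hs ts Js.
have [->|st] := eqVneq s t; first by rewrite subrr normr0 ltW.
have {}hs := hs st Js.
have qa : `|(s - t)^-1 * (h s - h t)| <= `|a| + 1.
  by rewrite -lerBlDl (le_trans (lerB_dist _ _))// distrC.
have st0 : s - t != 0 by rewrite subr_eq0.
rewrite distrC -[h s - h t](mulVKf st0) normrM [`|s - t|]distrC.
rewrite (@le_trans _ _ (e / (`|a| + 1) * (`|a| + 1)))//.
  exact: ler_pM.
by rewrite divfK// gt_eqF// ltr_wpDl.
Qed.

Lemma derivative_within_interior J h t a : nbhs t J ->
  derivative_within J h t a -> is_derive t (1 : R) h a.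
Proof.
move=> Jt hJ.
have cv : (fun k : R => k^-1 *: ((h \o shift t) (k *: (1 : R)) - h t)) @ 0^'
    --> a.
  apply/cvgrPdist_le => e e0.
  move/cvgrPdist_le : hJ => /(_ e e0) hq.
  have {}hq : \forall s \near t, s != t -> J s ->
    `|a - (s - t)^-1 * (h s - h t)| <= e := hq.
  have {hq} : \forall s \near t, s != t -> `|a - (s - t)^-1 * (h s - h t)| <= e.
    by apply: filterS2 Jt hq => s Js hs st; exact: hs.
  suff E : (\forall s \near t, s != t -> `|a - (s - t)^-1 * (h s - h t)| <= e) ->
    \forall k \near (0 : R), k != 0 ->
      `|a - k^-1 *: ((h \o shift t) (k *: (1 : R)) - h t)| <= e by exact: E.
  rewrite (near_shift 0) subr0; apply: filterS => k /= + k0.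
  rewrite addrK scaler1; apply.
  by rewrite -subr_eq0 addrK.
by apply: DeriveDef; [apply/cvg_ex; exists a; exact: cv|exact: (cvg_lim _ cv)].
Qed.

Lemma within_at_right I (d t : R) : 0 < d ->
  (forall s, t <= s <= t + d -> I s) ->
  t^'+ `=>` within I t^'.
Proof.
move=> d0 dI P IP.
have {IP} : \forall s \near t, s != t -> I s -> P s := IP.
suff E : (\forall s \near t, s != t -> I s -> P s) ->
  \forall s \near t, t < s -> P s by exact: E.
have : \forall s \near t, s <= t + d.
  have td : t < t + d by rewrite ltrDl.
  by near=> s; apply: ltW; near: s; exact: lt_nbhsl.
apply: filterS2 => s sd Ps ts; apply: Ps; first by rewrite gt_eqF.
by apply: dI; rewrite sd ltW.
Unshelve. all: by end_near. Qed.

Lemma has_derivative_within_coord n I (u : R -> 'rV[R]_n) t v k :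
  has_derivative_within I u t v ->
  derivative_within I (fun s => u s 0 k) t (v 0 k).
Proof.
move=> uv.
rewrite /derivative_within.
rewrite (_ : (fun s => _) =
  (fun s => ((s - t)^-1 *: (u s - u t)) 0 k)); last first.
  by apply/funext => s; rewrite !mxE.
exact: (continuous_cvg _ (@coord_continuous _ _ _ 0 k v) uv).
Qed.

Lemma has_derivative_within_unique n I (d t : R) (u : R -> 'rV[R]_n) v w :
  0 < d -> (forall s, t <= s <= t + d -> I s) ->
  has_derivative_within I u t v -> has_derivative_within I u t w -> v = w.
Proof.
move=> d0 dI uv uw; apply/rowP => k.
have rc b : derivative_within I (fun s => u s 0 k) t b ->
   (s - t)^-1 * (u s 0 k - u t 0 k) @[s --> t^'+] --> b.
  by apply: cvg_trans; apply: cvg_app; exact: within_at_right d0 dI.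
have cv := rc _ (@has_derivative_within_coord _ _ _ _ _ k uv).
have cw := rc _ (@has_derivative_within_coord _ _ _ _ _ k uw).
by rewrite -(cvg_lim (@Rhausdorff R) cv) (cvg_lim _ cw).
Qed.

Lemma cvg_row n (T : Type) (F : set_system T) {FF : Filter F}
    (u : T -> 'rV[R]_n) (v : 'rV[R]_n) :
  (forall k, u s 0 k @[s --> F] --> v 0 k) -> u s @[s --> F] --> v.
Proof.
move=> uv; apply/cvg_ballP => e e0.
have /filter_forall : forall k, \forall s \near F, ball (v 0 k) e (u s 0 k).
  by move=> k; have /cvg_ballP := uv k; apply.
by apply: filterS => s sv; split => // i j; rewrite ord1; exact: sv.
Qed.

(** Let [tm] maximize the distance of the two solutions on an interval of
    length [e] starting at 0. By the mean value theorem each coordinate of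
    [s1 tm - s2 tm] is [tm] times a difference of values of [F], hence at most
    [e * L] times the maximal distance. As [L * e <= 1/2], the maximum is at
    most half of itself, so it is 0. *)
Lemma ode_unique m (F : 'I_m -> 'rV[R]_m -> R) (p : 'rV[R]_m)
    (s1 s2 : R -> 'rV[R]_m) (d : R) :
  (forall k, lipschitz_near p (F k)) -> s1 0 = p -> s2 0 = p -> 0 < d ->
  (forall t k, 0 <= t <= d ->
    derivative_within `[0, d] (fun s => s1 s 0 k) t (F k (s1 t))) ->
  (forall t k, 0 <= t <= d ->
    derivative_within `[0, d] (fun s => s2 s 0 k) t (F k (s2 t))) ->
  exists2 e, 0 < e & forall t, 0 <= t <= e -> s1 t = s2 t.
Proof.
move=> lipF s10 s20 d0 ds1 ds2.
have cont (s : R -> 'rV[R]_m) : (forall t k, 0 <= t <= d ->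
    derivative_within `[0, d] (fun r => s r 0 k) t (F k (s t))) ->
    forall t, 0 <= t <= d -> s r @[r --> within `[0, d] (nbhs t)] --> s t.
  by move=> ds t td; apply: cvg_row => k;
    apply: derivative_within_continuous (ds t k _).
have c1 := cont _ ds1; have c2 := cont _ ds2.
have [L L0 LP] : exists2 L, 0 <= L & \forall yz \near (p, p), forall k,
    `|F k yz.1 - F k yz.2| <= L * `|yz.1 - yz.2|.
  have lipF_ex k : exists l : R, 0 <= l /\
      \forall yz \near (p, p), `|F k yz.1 - F k yz.2| <= l * `|yz.1 - yz.2|.
    by have [l l0 lk] := lipF k; exists l.
  have [l lP] := choice lipF_ex.
  exists (\sum_k l k); first by apply: sumr_ge0 => k _; case: (lP k).
  have near_k k : \forall yz \near (p, p),
      `|F k yz.1 - F k yz.2| <= (\sum_k l k) * `|yz.1 - yz.2|.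
    have [_ lk] := lP k; apply: filterS lk => yz /le_trans; apply.
    rewrite ler_wpM2r// (bigD1 k)//= lerDl.
    by apply: sumr_ge0 => j _; case: (lP j).
  exact: filter_forall near_k.
have d00 : (0 : R) <= 0 <= d by rewrite lexx ltW.
have /(_ _ LP) near0 :
    (s1 r, s2 r) @[r --> within `[0, d] (nbhs (0 : R))] --> (nbhs p, nbhs p).
  by apply: cvg_pair; [rewrite -s10; exact: c1|rewrite -s20; exact: c2].
have {near0} : \forall r \near (0 : R), 0 <= r <= d -> forall k,
    `|F k (s1 r) - F k (s2 r)| <= L * `|s1 r - s2 r| by exact: near0.
move=> /nbhs_ballP[c /= c0 Lip].
(* The bounds keep [0, e] inside the domain of both solutions and inside the
   range where the Lipschitz estimate holds, and give [L * e <= 1/2]; [L + 1]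
   replaces [L], which may be 0. *)
pose e := Num.min d (Num.min (c / 2) (2 * (L + 1))^-1).
have L1 : 0 < 2 * (L + 1) by rewrite mulr_gt0// ltr_wpDl.
have e0 : 0 < e by rewrite !lt_min d0 divr_gt0//= invr_gt0.
have ed : e <= d by rewrite ge_min lexx.
have ec : e < c.
  have hc : c / 2 < c by rewrite ltr_pdivrMr// ltr_pMr// ltr1n.
  by apply: le_lt_trans hc; rewrite /e !ge_min lexx orbT.
have eL : L * e <= 2^-1.
  rewrite (@le_trans _ _ ((L + 1) * (2 * (L + 1))^-1))//.
    by rewrite ler_pM ?lerDl// ?(ltW e0)// /e !ge_min lexx !orbT.
  by rewrite invfM mulrCA mulfV ?mulr1// gt_eqF// ltr_wpDl.
have ecd t : 0 <= t <= e -> 0 <= t <= d by move=> /andP[-> /le_trans ->].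
have {}Lip t k : 0 <= t <= e ->
    `|F k (s1 t) - F k (s2 t)| <= L * `|s1 t - s2 t|.
  move=> te; apply: Lip; last exact: ecd.
  by case/andP: te => t0 te; rewrite /ball/= sub0r normrN ger0_norm//
    (le_lt_trans te).
have cwithin (V : normedModType R) (g : R -> V) :
    (forall t, 0 <= t <= d -> g r @[r --> within `[0, d] (nbhs t)] --> g t) ->
    forall t, 0 <= t <= e -> {within `[0, t], continuous g}.
  move=> cg t te.
  apply: (@continuous_subspaceW _ _ _ `[0, d]).
    move=> r /=; rewrite !in_itv/= => /andP[-> /le_trans]; apply.
    by case/andP: te => _ /le_trans; apply.
  apply/subspace_continuousP => r /=; rewrite in_itv/=; exact: cg.
have [|tm] := @EVT_max R (fun t => `|s1 t - s2 t|) 0 e (ltW e0).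
  apply: cwithin; last by rewrite lexx ltW.
  by move=> t td; apply: cvg_norm; apply: cvgB; [exact: c1|exact: c2].
rewrite in_itv/= => tme tmax.
suff tm0 : `|s1 tm - s2 tm| <= `|s1 tm - s2 tm| / 2.
  exists e => // t te; apply/eqP; rewrite -subr_eq0 -normr_le0.
  rewrite (le_trans (tmax t _)) ?in_itv//.
  by move: tm0; rewrite ler_pdivlMr// mulr_natr mulr2n gerDl.
have [tm00 tme1] := andP tme.
apply/mx_norm_leP; first by rewrite divr_ge0.
move=> i k; rewrite ord1 !mxE.
have [||r + rE] := @MVT_segment R (fun t => s1 t 0 k - s2 t 0 k)
    (fun t => F k (s1 t) - F k (s2 t)) 0 tm tm00.
- move=> r; rewrite in_itv/= => /andP[r0 rtm].
  have rd : r < d by rewrite (lt_le_trans rtm)// (le_trans tme1).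
  have rn : nbhs r `[0, d]%classic.
    by near=> q; rewrite /= in_itv/=; apply/andP; split; apply: ltW; near: q;
      [exact: lt_nbhsr|exact: lt_nbhsl].
  have rd' : 0 <= r <= d by rewrite !ltW.
  by apply: is_deriveB; apply: derivative_within_interior rn _;
    [exact: ds1|exact: ds2].
- apply: cwithin => // t td; apply: cvgB.
    exact: derivative_within_continuous (ds1 t k td).
  exact: derivative_within_continuous (ds2 t k td).
rewrite in_itv/= => /andP[r0 rtm].
move: rE; rewrite s10 s20 subrr !subr0 => ->.
have re : 0 <= r <= e by rewrite r0 (le_trans rtm).
rewrite normrM (ger0_norm tm00).
rewrite (@le_trans _ _ (L * `|s1 tm - s2 tm| * e))//.
  rewrite ler_pM// (le_trans (Lip _ _ re))// ler_wpM2l// tmax// in_itv//.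
by rewrite mulrAC mulrC ler_wpM2l.
Unshelve. all: by end_near. Qed.

End OneSidedDerivative.

(** * Local uniqueness of geodesics *)

Section Geodesics.
Variables (R : realType) (n : nat) (M : topologicalType).
Variable G : riemannian_manifold R n M.

(** A kernel vector would have length 0, against positive definiteness. *)
Lemma metric_unit c y : atlas G c -> chart_cod c y ->
  metric G c y \in unitmx.
Proof.
move=> Gc cy; rewrite unitmxE unitfE; apply/negP => /det0P[v v0 vg].
by have := metric_pos Gc cy v0; rewrite vg mul0mx mxE ltxx.
Qed.

Lemma lipschitz_near_christoffel c y k i j : atlas G c -> chart_cod c y ->
  lipschitz_near y (fun z => christoffel G c z k i j).
Proof.
move=> Gc cy; have oc := @chart_cod_open _ _ _ c.
have lip_metric a b : lipschitz_near y (fun z => metric G c z a b).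
  exact: (lipschitz_near_Ck oc cy (metric_smooth Gc a b 1)).
have lip_partial a b l :
    lipschitz_near y (partial l (fun z => metric G c z a b)).
  have [_ /(_ l) [_]] := metric_smooth Gc a b 2.
  exact: lipschitz_near_Ck oc cy.
apply/lipschitz_nearZ/lipschitz_near_sum => l.
apply: lipschitz_nearM.
  by apply: lipschitz_near_invmx => //; exact: metric_unit.
apply: lipschitz_nearD; last exact: lipschitz_nearN.
exact: lipschitz_nearD.
Qed.

(** The geodesic equation as a first-order system: the first half of [y] is the
    position in the chart and the second half is the velocity. *)
Definition geodesic_field (c : chart R n M) (k : 'I_(n + n))
    (y : 'rV[R]_(n + n)) : R :=
  match fintype.split k with
  | inl i => rsubmx y 0 i
  | inr i => - (\sum_(a < n) \sum_(b < n) christoffel G c (lsubmx y) i a b *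
                  rsubmx y 0 a * rsubmx y 0 b)
  end.

Lemma lipschitz_near_rsubmx (y : 'rV[R]_(n + n)) i :
  lipschitz_near y (fun z => rsubmx z 0 i).
Proof.
under eq_fun do rewrite mxE; exact: lipschitz_near_coord.
Qed.

Lemma lipschitz_near_lsubmx (y : 'rV[R]_(n + n)) (f : 'rV[R]_n -> R) :
  lipschitz_near (lsubmx y) f -> lipschitz_near y (fun z => f (lsubmx z)).
Proof.
apply: (@lipschitz_near_comp R _ (lsubmx y) _
  (fun z : 'rV[R]_(n + n) => lsubmx z) y f erefl).
  apply: (@cvg_row _ _ _ (nbhs y)) => k; under eq_fun do rewrite mxE.
  by rewrite mxE; exact: coord_continuous.
move=> z z'; apply/mx_norm_leP => // i j.
have := le_mx_norm (z - z') i (lshift n j); rewrite !mxE; exact.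
Qed.

Lemma lipschitz_near_geodesic_field c y k : atlas G c ->
  chart_cod c (lsubmx y) -> lipschitz_near y (geodesic_field c k).
Proof.
move=> Gc cy; rewrite /geodesic_field; case: fintype.split => i.
  exact: lipschitz_near_rsubmx.
apply: lipschitz_nearN; apply: lipschitz_near_sum => a.
apply: lipschitz_near_sum => b.
apply: lipschitz_nearM; last exact: lipschitz_near_rsubmx.
apply: lipschitz_nearM; last exact: lipschitz_near_rsubmx.
apply: (@lipschitz_near_lsubmx _ (fun z => christoffel G c z i a b)).
exact: lipschitz_near_christoffel.
Qed.

Lemma geodesic_in_chart E x (X : tangent G x) I gamma (c : chart R n M) :
  geodesic_in E X I gamma -> chart_dom c x ->
  exists2 d, 0 < d & forall t, 0 <= t <= d -> I t /\ chart_dom c (gamma t).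
Proof.
move=> [itvI I0 [s Is s0] _ [[cgamma _] [gamma0 _]]] cx.
have {}cgamma : gamma r @[r --> within I (nbhs (0 : R))] --> x.
  by move/subspace_continuousP : cgamma => /(_ 0 I0); rewrite -gamma0.
have cn : nbhs x (chart_dom c).
  by apply: open_nbhs_nbhs; split => //; exact: chart_dom_open.
have near0 := cgamma _ cn.
have {near0} : \forall t \near (0 : R), I t -> chart_dom c (gamma t) := near0.
move=> /nbhs_ballP[e /= e0 dom].
exists (Num.min s (e / 2)); first by rewrite lt_min s0 divr_gt0.
move=> t /andP[t0]; rewrite le_min => /andP[ts te].
have It : I t by apply: (itvI _ _ I0 Is); rewrite t0.
split => //; apply: dom => //; rewrite /ball/= sub0r normrN ger0_norm//.
by rewrite (le_lt_trans te)// ltr_pdivrMr// ltr_pMr// ltr1n.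
Qed.

(** The velocity [w] comes with the geodesic equation and [X c] with the initial
    condition; at 0 both are derivatives of the same curve, and 0 is a limit
    point of [I], so they coincide. *)
Lemma geodesic_curve_eq E x (X : tangent G x) I gamma (c : chart R n M) :
  geodesic_in E X I gamma -> atlas G c -> chart_dom c x ->
  exists w : R -> 'rV[R]_n, [/\ w 0 = X c &
    exists2 d, 0 < d & forall t, 0 <= t <= d -> chart_dom c (gamma t) /\
      forall e k, e <= d ->
        let s := fun t => row_mx (chart_map c (gamma t)) (w t) in
        derivative_within `[0, e] (fun t => s t 0 k) t
          (geodesic_field c k (s t))].
Proof.
move=> geo Gc cx.
have [d d0 dI] := geodesic_in_chart geo cx.
have [_ I0 _ _ [[_ /(_ c Gc)[w eqw]] [gamma0 /(_ c Gc cx) vel]]] := geo.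
exists w; split.
  have [|dw _] := eqw 0 I0; first by rewrite gamma0.
  apply: has_derivative_within_unique d0 _ dw vel => t.
  by rewrite add0r => /dI[].
exists d => // t td; have [It ct] := dI t td; split => // e k ed s.
have eI : `[0, e]%classic `<=` I.
  move=> r /=; rewrite in_itv/= => /andP[r0 re].
  by have [] := dI r _; rewrite ?r0 ?(le_trans re).
have [du dw] := eqw t It ct.
have [j ->|j ->] := split_ordP k.
  rewrite /geodesic_field (unsplitK (inl j)) /s row_mxKr.
  rewrite [X in derivative_within _ X](_ : _ =
    fun r => chart_map c (gamma r) 0 j).
    exact/(derivative_within_subset eI)/has_derivative_within_coord.
  by apply/funext => r; rewrite row_mxEl.
rewrite /geodesic_field (unsplitK (inr j)) /s row_mxKr row_mxKl.
rewrite [X in derivative_within _ X](_ : _ = fun r => w r 0 j).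
  have := @has_derivative_within_coord _ _ _ _ _ _ j dw; rewrite mxE.
  exact: derivative_within_subset.
by apply/funext => r; rewrite row_mxEr.
Qed.

(** Two solutions of the system with the common initial value
    [row_mx (chart_map c x) (X c)]; the chart, being injective on its domain,
    turns equality of coordinates into equality of points. *)
Lemma geodesic_local_unique E1 E2 x (X : tangent G x) I1 I2 gamma1 gamma2 :
  geodesic_in E1 X I1 gamma1 -> geodesic_in E2 X I2 gamma2 ->
  \forall s \near 0^'+, gamma1 s = gamma2 s.
Proof.
move=> geo1 geo2; have [c Gc cx] := atlas_cover G x.
have [w1 [w10 [d1 d10 eq1]]] := geodesic_curve_eq geo1 Gc cx.
have [w2 [w20 [d2 d20 eq2]]] := geodesic_curve_eq geo2 Gc cx.
have [_ _ _ _ [_ [gamma10 _]]] := geo1.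
have [_ _ _ _ [_ [gamma20 _]]] := geo2.
pose d := Num.min d1 d2.
have d0 : 0 < d by rewrite lt_min d10.
have dd1 : d <= d1 by rewrite ge_min lexx.
have dd2 : d <= d2 by rewrite ge_min lexx orbT.
have [||||t k td|t k td|e e0 eq12] := @ode_unique _ _ (geodesic_field c)
  (row_mx (chart_map c x) (X c))
  (fun t => row_mx (chart_map c (gamma1 t)) (w1 t))
  (fun t => row_mx (chart_map c (gamma2 t)) (w2 t)) d.
- by move=> k; apply: lipschitz_near_geodesic_field; rewrite // row_mxKl; exists x.
- by rewrite gamma10 w10.
- by rewrite gamma20 w20.
- by [].
- have /eq1[_] : 0 <= t <= d1 by case/andP: td => -> /le_trans ->.
  exact.
- have /eq2[_] : 0 <= t <= d2 by case/andP: td => -> /le_trans ->.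
  exact.
near=> t.
have t0 : 0 <= t by near: t; exact: nbhs_right_ge.
have td : t <= d by near: t; exact: nbhs_right_le.
have te : t <= e by near: t; exact: nbhs_right_le.
have /eq1[c1 _] : 0 <= t <= d1 by rewrite t0 (le_trans td).
have /eq2[c2 _] : 0 <= t <= d2 by rewrite t0 (le_trans td).
rewrite -(chart_mapK c1) -(chart_mapK c2).
have /eq12 : 0 <= t <= e by rewrite t0.
by move=> /eq_row_mx[-> _].
Unshelve. all: by end_near. Qed.

End Geodesics.

(** * Difference quotients of interval-valued functions *)

Section Intervals.
Variable R : realType.
Implicit Types A B : cbitv R.

Lemma cbitv_eq A B : lower A = lower B -> upper A = upper B -> A = B.
Proof.
case: A B => [l u lu] [l' u' lu'] /= ll uu; subst l' u'.
by congr Cbitv; exact: bool_irrelevance.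
Qed.

Lemma lowerE A : lower A = cbitv_center A - cbitv_halfwidth A.
Proof. by rewrite /cbitv_center /cbitv_halfwidth; field. Qed.

Lemma upperE A : upper A = cbitv_center A + cbitv_halfwidth A.
Proof. by rewrite /cbitv_center /cbitv_halfwidth; field. Qed.

(** When the half-width does not decrease from [B] to [A], the minimum and the
    maximum in the gH-difference are the differences of the lower and of the
    upper endpoints. *)
Lemma hausdorff_gH_quotient (A B C : cbitv R) (s : R) : 0 < s ->
  cbitv_halfwidth B <= cbitv_halfwidth A ->
  hausdorff_dist (scale_cbitv s^-1 (gH_diff A B)) C =
  Num.max `|(lower A - lower B) / s - lower C|
          `|(upper A - upper B) / s - upper C|.
Proof.
move=> s0 BA.
have lu : lower A - lower B <= upper A - upper B by rewrite !lowerE !upperE;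
  lra.
by rewrite /hausdorff_dist /= invr_ge0 (ltW s0) (min_l lu) (max_r lu)
  !(mulrC s^-1).
Qed.

Lemma cvg_gH_quotient (F : R -> cbitv R) (B C : cbitv R) :
  (\forall s \near 0^'+, cbitv_halfwidth B <= cbitv_halfwidth (F s)) ->
  hausdorff_dist (scale_cbitv s^-1 (gH_diff (F s) B)) C
    @[s --> 0^'+] --> (0 : R)
  <->
  (cbitv_center (F s) - cbitv_center B) / s @[s --> 0^'+] --> cbitv_center C /\
  (cbitv_halfwidth (F s) - cbitv_halfwidth B) / s @[s --> 0^'+] -->
    cbitv_halfwidth C.
Proof.
move=> BF.
pose l s := (lower (F s) - lower B) / s.
pose u s := (upper (F s) - upper B) / s.
have distE : \forall s \near 0^'+, Num.max `|l s - lower C| `|u s - upper C| =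
    hausdorff_dist (scale_cbitv s^-1 (gH_diff (F s) B)) C.
  have spos : \forall s \near (0 : R)^'+, 0 < s by exact: nbhs_right_gt.
  by apply: filterS2 spos BF => s s0 BFs; rewrite hausdorff_gH_quotient.
split.
  move=> dist0.
  have cl : l s @[s --> 0^'+] --> lower C.
    apply/cvgrPdist_le => e e0.
    move/cvgrPdist_le : dist0 => /(_ e e0); apply: filterS2 distE => s <-.
    rewrite sub0r normrN ger0_norm ?le_max ?normr_ge0// ge_max.
    by rewrite distrC => /andP[].
  have cu : u s @[s --> 0^'+] --> upper C.
    apply/cvgrPdist_le => e e0.
    move/cvgrPdist_le : dist0 => /(_ e e0); apply: filterS2 distE => s <-.
    rewrite sub0r normrN ger0_norm ?le_max ?normr_ge0// ge_max.
    by rewrite [X in _ -> X <= _]distrC => /andP[].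
  split.
    rewrite (_ : (fun s => _) = (fun s => (l s + u s) / 2)).
      by apply: cvgMr_tmp; exact: cvgD.
    by apply/funext => s; rewrite /l /u /cbitv_center; ring.
  rewrite (_ : (fun s => _) = (fun s => (u s - l s) / 2)).
    by apply: cvgMr_tmp; exact: cvgB.
  by apply/funext => s; rewrite /l /u /cbitv_halfwidth; ring.
move=> [cc cw].
have cl : l s @[s --> 0^'+] --> lower C.
  rewrite lowerE (_ : l = (fun s => (cbitv_center (F s) - cbitv_center B) / s -
    (cbitv_halfwidth (F s) - cbitv_halfwidth B) / s)); first exact: cvgB.
  by apply/funext => s; rewrite /l !lowerE; ring.
have cu : u s @[s --> 0^'+] --> upper C.
  rewrite upperE (_ : u = (fun s => (cbitv_center (F s) - cbitv_center B) / s +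
    (cbitv_halfwidth (F s) - cbitv_halfwidth B) / s)); first exact: cvgD.
  by apply/funext => s; rewrite /u !upperE; ring.
apply/cvgrPdist_le => e e0.
move/cvgrPdist_le : cl => /(_ e e0) cl; move/cvgrPdist_le : cu => /(_ e e0) cu.
near=> s; have -> : hausdorff_dist (scale_cbitv s^-1 (gH_diff (F s) B)) C =
  Num.max `|l s - lower C| `|u s - upper C| by apply/esym; near: s.
rewrite sub0r normrN ger0_norm ?le_max ?normr_ge0// ge_max.
by rewrite distrC [X in _ && (X <= _)]distrC; apply/andP; split; near: s.
Unshelve. all: by end_near. Qed.

End Intervals.

(** * Directional derivatives along a fixed geodesic *)

Section Transfer.
Variables (R : realType) (n : nat) (M : topologicalType).
Variables (G : riemannian_manifold R n M) (E : set M) (x : M) (X : tangent G x).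
Variables (I : set R) (gamma : R -> M).
Hypothesis geo : geodesic_in E X I gamma.

(** A limit at 0 from the right depends only on the values for small [s > 0],
    where the two geodesics coincide. *)
Lemma cvg_along_geodesic (T : Type) (F : R -> M -> T) (L : set_system T)
    I' gamma' :
  geodesic_in E X I' gamma' ->
  F s (gamma' s) @[s --> 0^'+] --> L -> F s (gamma s) @[s --> 0^'+] --> L.
Proof.
move=> geo'; apply: cvg_trans; apply: near_eq_cvg.
by apply: filterS (geodesic_local_unique geo geo') => s /= ->.
Qed.

Lemma has_dir_derivative_along h a : has_dir_derivative E h X a <->
  (h (gamma s) - h x) / s @[s --> 0^'+] --> a.
Proof.
split; last by exists I, gamma.
move=> [I' [gamma' [geo' hc]]].
exact: (cvg_along_geodesic (F := fun s p => (h p - h x) / s) geo').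
Qed.

Lemma has_gH_dir_derivative_along f A : has_gH_dir_derivative E f X A <->
  hausdorff_dist (scale_cbitv s^-1 (gH_diff (f (gamma s)) (f x))) A
    @[s --> 0^'+] --> (0 : R).
Proof.
split; last by exists I, gamma.
move=> [I' [gamma' [geo' hc]]].
exact: (cvg_along_geodesic
  (F := fun s p => hausdorff_dist
     (scale_cbitv s^-1 (gH_diff (f p) (f x))) A) geo').
Qed.

Lemma near_geodesic_domain : \forall s \near 0^'+, I s.
Proof.
have [itvI I0 [d Id d0] _ _] := geo.
near=> s; apply: (itvI _ _ I0 Id); apply/andP; split.
  by near: s; exact: nbhs_right_ge.
by near: s; exact: nbhs_right_le.
Unshelve. all: by end_near. Qed.

End Transfer.

Theorem lemma4p4 (R : realType) (n : nat) (M : topologicalType)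
    (G : riemannian_manifold R n M) (complete_G : complete_manifold G)
    (E : set M) (f : M -> cbitv R) (x : M) (Ex : E x)
    (X : tangent G x) (X_tangent : tangent_set E X)
    (I : set R) (gamma : R -> M) (gamma_geodesic : geodesic_in E X I gamma)
    (fw_nondecreasing : forall s t, I s -> I t -> 0 <= s -> s <= t ->
       cbitv_halfwidth (f (gamma s)) <= cbitv_halfwidth (f (gamma t))) :
  ((exists A, has_gH_dir_derivative E f X A) <->
   (exists a, has_dir_derivative E (fun p => cbitv_center (f p)) X a) /\
   (exists b, has_dir_derivative E (fun p => cbitv_halfwidth (f p)) X b)) /\
  (forall A a b,
     has_gH_dir_derivative E f X A ->
     has_dir_derivative E (fun p => cbitv_center (f p)) X a ->
     has_dir_derivative E (fun p => cbitv_halfwidth (f p)) X b ->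
     exists b_ge0 : 0 <= b, A = cbitv_cw a b_ge0).
Proof.
have [_ I0 _ _ [_ [gamma0 _]]] := gamma_geodesic.
have width_le : \forall s \near 0^'+,
    cbitv_halfwidth (f x) <= cbitv_halfwidth (f (gamma s)).
  have spos : \forall s \near (0 : R)^'+, 0 <= s by exact: nbhs_right_ge.
  apply: filterS2 spos (near_geodesic_domain gamma_geodesic) => s s0 Is.
  by rewrite -gamma0; exact: fw_nondecreasing.
have gH_iff A : has_gH_dir_derivative E f X A <->
    has_dir_derivative E (fun p => cbitv_center (f p)) X (cbitv_center A) /\
    has_dir_derivative E (fun p => cbitv_halfwidth (f p)) X (cbitv_halfwidth A).
  rewrite (has_gH_dir_derivative_along gamma_geodesic).
  rewrite !(has_dir_derivative_along gamma_geodesic).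
  exact: cvg_gH_quotient.
have dir_unique h a b : has_dir_derivative E h X a ->
    has_dir_derivative E h X b -> a = b.
  move=> /(has_dir_derivative_along gamma_geodesic) ha.
  move=> /(has_dir_derivative_along gamma_geodesic) hb.
  by rewrite -(cvg_lim (@Rhausdorff R) ha) (cvg_lim _ hb).
have halfwidth_dir_ge0 b :
    has_dir_derivative E (fun p => cbitv_halfwidth (f p)) X b -> 0 <= b.
  move=> /(has_dir_derivative_along gamma_geodesic) hb.
  have spos : \forall s \near (0 : R)^'+, 0 <= s by exact: nbhs_right_ge.
  apply: (cvgr_to_ge hb); apply: filterS2 spos width_le => s s0 ws.
  by rewrite divr_ge0 ?subr_ge0.
have center_cw a b (b0 : 0 <= b) : cbitv_center (cbitv_cw a b0) = a.
  by rewrite /cbitv_center /=; field.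
have halfwidth_cw a b (b0 : 0 <= b) : cbitv_halfwidth (cbitv_cw a b0) = b.
  by rewrite /cbitv_halfwidth /=; field.
split; first split.
- by move=> [A /gH_iff[hc hw]]; split; eexists; eassumption.
- move=> [[a ha] [b hb]]; have b0 := halfwidth_dir_ge0 b hb.
  by exists (cbitv_cw a b0); apply/gH_iff; rewrite center_cw halfwidth_cw.
- move=> A a b /gH_iff[hc hw] ha hb.
  exists (halfwidth_dir_ge0 b hb).
  by apply: cbitv_eq => /=; rewrite ?lowerE ?upperE (dir_unique _ _ _ ha hc)
    (dir_unique _ _ _ hb hw).
Unshelve. all: by end_near. Qed.
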